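(* Let $p$ be a prime, $n\ge 1$, $q=p^n$. Let $P\in\mathbb{F}_q[x]$ be a polynomial with additive index $k$ over $\mathbb{F}_q$, written as $P(x)=f(L(x))+M(x)$, where $f,L,M\in\mathbb{F}_q[x]$, $L=\mathcal{L}(P,q)$ (so $\deg(L)=p^{n-k}$) and $M$ is a $p$-linearized polynomial with $\deg(M)<\deg(L)$. If $\gcd(L(x),M(x))=x$ and $|V_P|>p^n-p^{n-k}$, then $P(x)$ is a permutation polynomial of $\mathbb{F}_q$.
   Context: A $p$-linearized polynomial is a polynomial of the form $\sum_{i=0}^m a_i x^{p^i}$ (the zero polynomial is allowed). For $P\in\mathbb{F}_q[x]$ put $P_0(x)=P(x)-P(0)$, let $V$ be the set of $y\in\mathbb{F}_q$ such that $P_0(x+y)-P_0(x)-P_0(y)=0$ in $\mathbb{F}_q[x]$, and set $\mathcal{L}(P,q)(x)=\prod_{v\in V}(x-v)$. Then $\mathcal{L}(P,q)$ is a monic $p$-linearized polynomial dividing $x^q-x$, and $P$ can be written as $f(\mathcal{L}(x))+M(x)$ with $f,M\in\mathbb{F}_q[x]$, $M$ $p$-linearized and $\deg(M)<\deg(\mathcal{L})$. If $\deg(\mathcal{L}(P,q))=p^{n-k}$, then $P$ is said to have additive index $k$ over $\mathbb{F}_q$. The value set of $P$ is $V_P=\{P(y):y\in\mathbb{F}_q\}$; $P$ is a permutation polynomial of $\mathbb{F}_q$ if $|V_P|=q$. The gcd is monic. *)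

(* Defs.v *)
From HB Require Import structures.
From mathcomp Require Import all_boot all_order all_algebra all_field.

Set Implicit Arguments.
Unset Strict Implicit.
Unset Printing Implicit Defensive.

Import GRing.Theory.
Local Open Scope ring_scope.

(* The zero polynomial is obtained with all [a i] equal to 0. *)
Definition linearized (F : finFieldType) (p : nat) (M : {poly F}) : Prop :=
  exists (m : nat) (a : nat -> F), M = \sum_(i < m.+1) a i *: 'X^(p ^ i).

Definition const_free (F : finFieldType) (P : {poly F}) : {poly F} :=
  P - (P.[0])%:P.

(* The equation is an identity of polynomials in x, with y in F fixed:
   [P \Po ('X + y%:P)] is P(x + y), and [P.[y]%:P] is the constant P(y). *)
Definition additive_shifts (F : finFieldType) (P : {poly F}) : {set F} :=
  [set y : F | const_free P \Po ('X + y%:P) - const_free P - ((const_free P).[y])%:P == 0].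

Definition calL (F : finFieldType) (P : {poly F}) : {poly F} :=
  \prod_(v in additive_shifts P) ('X - v%:P).

(* Over a field with p ^ n elements.  The bound on k guards against truncated
   subtraction; (size _).-1 is the degree, as calL P is never 0. *)
Definition additive_index (F : finFieldType) (p n : nat) (P : {poly F})
    (k : nat) : Prop :=
  (k <= n)%N /\ (size (calL P)).-1 = (p ^ (n - k))%N.

Definition value_set (F : finFieldType) (P : {poly F}) : {set F} :=
  [set P.[y] | y : F].

Definition permutation_poly (F : finFieldType) (P : {poly F}) : Prop :=
  #|value_set P| = #|F|.

(* gcdp is only defined up to a nonzero scalar. *)
Definition monic_gcdp (F : fieldType) (A B : {poly F}) : {poly F} :=
  (lead_coef (gcdp A B))^-1 *: gcdp A B.

(* Main.v *)
Require Import Defs.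
From HB Require Import structures.
From mathcomp Require Import all_boot all_order all_algebra all_field.

(** Let V be the set of additive shifts of P, an additive subgroup of F which
    is the root set of L and has p ^ (n - k) elements.  For v in V the increment
    P(x + v) - P(x) does not depend on x, so it is P(v) - P(0), and since L
    vanishes at v and at 0 the summand f(L) drops out and the increment is M(v)
    (lemmas [const_increment] and [increment_additive_shift]).  Hence the value
    set, and with it its complement, is stable under translation by M(V).

    The linearized polynomial M is additive on F (lemma [hornerB_linearized]),
    so it is injective on V: its kernel there consists of the common roots of L
    and M, and gcd(L, M) = x leaves only 0.  A missed value would therefore come
    with a whole coset of p ^ (n - k) missed values, which the lower bound on
    the size of the value set leaves no room for
    (lemma [full_of_translation_stable]). *)

Set Implicit Arguments.
Unset Strict Implicit.
Unset Printing Implicit Defensive.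

Import GRing.Theory.
Local Open Scope ring_scope.

(** A single point c outside A would put the whole translate c + W outside A,
    hence leave at least as many points outside A as there are in W. *)
Lemma full_of_translation_stable (G : finZmodType) (A W : {set G}) :
    (forall c w, w \in W -> c + w \in A -> c \in A) ->
  (#|G| - #|W| < #|A|)%N -> #|A| = #|G|.
Proof.
move=> stA ltA; suff -> : A = setT by rewrite cardsT.
apply/setP=> c; rewrite inE; apply: contraLR ltA => cNA; rewrite -leqNgt.
suff: (#|W| <= #|~: A|)%N.
  by move=> leW; rewrite -(cardsC A) -[leqLHS](addnK #|~: A|) leq_sub2l.
rewrite -(card_imset W (addrI c)); apply/subset_leq_card/subsetP=> d.
by case/imsetP=> w Ww ->; rewrite inE; apply: contra cNA; apply: stA.
Qed.

Section AdditiveShifts.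

Variables (F : finFieldType) (P : {poly F}).

Lemma additive_shiftsP v :
  reflect (const_free P \Po ('X + v%:P)
             = const_free P + ((const_free P).[v])%:P)
          (v \in additive_shifts P).
Proof. by rewrite inE subr_eq0 subr_eq [eqbRHS]addrC; apply: eqP. Qed.

Lemma horner_const_free x : (const_free P).[x] = P.[x] - P.[0].
Proof. by rewrite /const_free hornerD hornerN hornerC. Qed.

Lemma const_increment v x : v \in additive_shifts P ->
  P.[x + v] - P.[x] = P.[v] - P.[0].
Proof.
move=> /additive_shiftsP/(congr1 (horner^~ x)).
rewrite horner_comp !(horner_const_free, hornerX, hornerC, hornerD) => e.
have -> : P.[x + v] = P.[x] + (P.[v] - P.[0]).
  by rewrite -[LHS](subrK P.[0]) e [LHS]addrAC subrK.
by rewrite [LHS]addrC addKr.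
Qed.

(** The defining identity holds between polynomials, so another shift can be
    substituted for its variable: replacing x by x - v gives the identity for
    -v, and replacing x by x + u then gives the one for u - v. *)
Lemma additive_shiftsB u v :
    u \in additive_shifts P -> v \in additive_shifts P ->
  u - v \in additive_shifts P.
Proof.
move=> /additive_shiftsP Qu /additive_shiftsP Qv; apply/additive_shiftsP.
have := horner_const_free 0; rewrite subrr.
move: (const_free P) Qu Qv => Q Qu Qv Q0.
have eqN: Q \Po ('X - v%:P) = Q - (Q.[v])%:P.
  have := congr1 (fun R => R \Po ('X - v%:P)) Qv; rewrite -comp_polyA.
  rewrite !comp_polyD !comp_polyX !comp_polyC subrK comp_polyXr.
  by move/eqP; rewrite -subr_eq => /eqP.
have eqB: Q \Po ('X + (u - v)%:P) = Q + (Q.[u])%:P - (Q.[v])%:P.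
  rewrite polyCB addrA -[X in Q \Po (X - _)]comp_polyX.
  have -> : ('X \Po ('X + u%:P)) - v%:P = ('X - v%:P) \Po ('X + u%:P).
    by rewrite comp_polyD comp_polyX -polyCN comp_polyC.
  by rewrite comp_polyA eqN comp_polyB comp_polyC Qu.
rewrite eqB.
have := congr1 (horner^~ 0) eqB.
rewrite horner_comp !(hornerD, hornerN, hornerX, hornerC) Q0 !add0r => ->.
by rewrite polyCB addrA.
Qed.

Lemma root_calL v : root (calL P) v = (v \in additive_shifts P).
Proof. by rewrite /calL -big_enum root_prod_XsubC mem_enum. Qed.

Lemma size_calL : size (calL P) = #|additive_shifts P|.+1.
Proof. by rewrite /calL -big_enum size_prod_XsubC -cardE. Qed.

(** The increment along v is P(v) - P(0), in which f(L) takes the same value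
    f(0) twice. *)
Lemma increment_additive_shift (f M : {poly F}) v x :
    P = (f \Po calL P) + M -> root (calL P) 0 -> M.[0] = 0 ->
  v \in additive_shifts P -> P.[x + v] = P.[x] + M.[v].
Proof.
move=> defP L0 M0 Vv; have := Vv; rewrite -root_calL => /eqP Lv.
have hornerP y : P.[y] = f.[(calL P).[y]] + M.[y].
  by rewrite {1}defP hornerD horner_comp.
apply/eqP; rewrite [eqbRHS]addrC -subr_eq const_increment //.
by rewrite !hornerP Lv (eqP L0) M0 addr0 [_ + M.[v]]addrC addrK.
Qed.

End AdditiveShifts.

Lemma hornerB_linearized (F : finFieldType) (p : nat) (M : {poly F}) :
    p \in [pchar F] -> linearized p M ->
  forall x y, M.[x - y] = M.[x] - M.[y].
Proof.
move=> pF [m [a ->]] x y; rewrite !horner_sum -sumrB; apply: eq_bigr => i _.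
rewrite !hornerE -mulrBr; congr (_ * _).
elim: (nat_of_ord i) => [|j IHj]; first by rewrite !expr1.
by rewrite expnSr !exprM IHj -!(pFrobenius_autE pF) rmorphB.
Qed.

Lemma root_monic_gcdp (F : fieldType) (A B : {poly F}) x :
  monic_gcdp A B = 'X -> (root A x && root B x) = (x == 0).
Proof.
move=> gX; rewrite -root_gcd; have g0: lead_coef (gcdp A B) != 0.
  apply: contraTneq isT => g0; have := polyX_eq0 F.
  by rewrite -gX /monic_gcdp g0 invr0 scale0r eqxx.
by rewrite -(rootZ x (gcdp A B) (invr_neq0 g0)) -/(monic_gcdp A B) gX rootX.
Qed.

Theorem corollary4p5 (F : finFieldType) (p n k : nat)
    (hp : prime p) (hn : (1 <= n)%N) (hF : #|F| = (p ^ n)%N)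
    (P f L M : {poly F})
    (hk : additive_index p n P k)
    (hL : L = calL P)
    (hM : linearized p M)
    (hdeg : (size M < size L)%N)
    (hP : P = (f \Po L) + M)
    (hgcd : monic_gcdp L M = 'X)
    (hV : (p ^ n - p ^ (n - k) < #|value_set P|)%N) :
  permutation_poly P.
Proof.
subst L; have rootLM x := root_monic_gcdp x hgcd.
have /andP[L0 /eqP M0]: root (calL P) 0 && root M 0 by rewrite rootLM.
have MB := hornerB_linearized (card_finPcharP hF hp) hM.
have injM: {in additive_shifts P &, injective (horner M)}.
  move=> u v Vu Vv /eqP; rewrite -subr_eq0 -MB => MuvB.
  apply/eqP; rewrite -subr_eq0 -rootLM; apply/andP; split=> //.
  by rewrite root_calL additive_shiftsB.
have cardMV: #|[set M.[v] | v in additive_shifts P]| = (p ^ (n - k))%N.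
  by rewrite card_in_imset //; case: hk => _ <-; rewrite size_calL.
set W := [set M.[v] | v in _] in cardMV.
apply: (@full_of_translation_stable _ _ W).
  move=> c _ /imsetP[v Vv ->] /imsetP[x _ cMx]; apply/imsetP.
  exists (x - v) => //; apply: (addIr M.[v]).
  by rewrite cMx -(increment_additive_shift _ hP L0 M0 Vv) subrK.
by rewrite cardMV hF.
Qed.
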